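(* Let $p,q$ be positive integers with $p<q$. Let $t_i$, $2\le i\le n$, be positive integers such that $$\sum_{i=2}^{n}\frac{1}{t_i}=\frac{p}{q-p}\quad\text{and}\quad t_i\ge \frac{q}{p}\ \text{ for all } 2\le i\le n.$$ For all $2\le i\le n$ let $r_i=2t_i$ and $s_i=2t_i-1$. Let $G=N(K_{1,1},K_{r_2,s_2},\dots,K_{r_n,s_n})$ be the necklace graph, and let $e_1$ be the key edge of $G$ coming from the first graph $K_{1,1}$ (i.e. its only edge). Then $\mathrm{dep}(G)=d_G(e_1)=p/q$.
   Context: For a connected graph $G$, $\tau(G)$ is the number of spanning trees of $G$, and for $e\in E(G)$, $\tau_G(e)$ is the number of spanning trees of $G$ containing $e$. The spanning tree edge density of $e$ is $d_G(e)=\tau_G(e)/\tau(G)$, and the spanning tree edge dependence of $G$ is $\mathrm{dep}(G)=\max_{e\in E(G)}d_G(e)$. Necklace graph: given vertex-disjoint connected graphs $G_1,\dots,G_n$ ($n\ge 2$) with a chosen edge $e_i=u_iv_i$ in each $G_i$, the necklace graph $N(G_1,\dots,G_n)$ is obtained from the disjoint union of the $G_i$ by identifying $v_i$ with $u_{i+1}$ for every $i$ (indices modulo $n$, so $v_n$ is identified with $u_1$). Distinct edges remain distinct edges. The edges $e_1,\dots,e_n$ are the key edges. $K_{r,s}$ is the complete bipartite graph with parts of sizes $r$ and $s$. In $N(K_{r_1,s_1},\dots,K_{r_n,s_n})$ the chosen edge $e_i=u_iv_i$ is an edge of $K_{r_i,s_i}$ with $u_i$ in the part of size $r_i$ and $v_i$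 in the part of size $s_i$. *)

(* Defs.v *)
From mathcomp Require Import all_boot all_order all_algebra.
Set Implicit Arguments.
Unset Strict Implicit.
Unset Printing Implicit Defensive.
Import Order.TTheory GRing.Theory Num.Theory.

(* Finite multigraphs: edges have their own identity, so parallel edges (and
   loops) are allowed.  The order of the two ends of an edge is irrelevant. *)
Record multigraph := Multigraph {
  vertex : finType;
  edge : finType;
  ends : edge -> vertex * vertex
}.

Definition joins (G : multigraph) (e : edge G) (x y : vertex G) : bool :=
  (ends e == (x, y)) || (ends e == (y, x)).

Definition adjacent (G : multigraph) (T : {set edge G}) : rel (vertex G) :=
  fun x y => [exists e in T, joins e x y].

Definition connected (G : multigraph) (T : {set edge G}) : bool :=
  [forall x, forall y, connect (adjacent T) x y].

(* A cycle of length k.+1 visits distinct vertices x 0, ..., x k along distinct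
   edges c 0, ..., c k, with c i joining x i to x (i + 1 mod k.+1).  Length 1 is
   a loop and length 2 a pair of parallel edges.  As x is injective, bounding
   the length by #|vertex G| loses nothing. *)
Definition has_cycle (G : multigraph) (T : {set edge G}) : bool :=
  [exists k : 'I_#|vertex G|,
   exists x : {ffun 'I_k.+1 -> vertex G},
   exists c : {ffun 'I_k.+1 -> edge G},
   [&& injectiveb x, injectiveb c
     & [forall i, (c i \in T) && joins (c i) (x i) (x (ordS i))]]].

Definition spanning_tree (G : multigraph) (T : {set edge G}) : bool :=
  connected T && ~~ has_cycle T.

Definition tau (G : multigraph) : nat :=
  #|[set T : {set edge G} | spanning_tree T]|.

Definition tau_edge (G : multigraph) (e : edge G) : nat :=
  #|[set T : {set edge G} | spanning_tree T && (e \in T)]|.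

Definition density (G : multigraph) (e : edge G) : rat :=
  ((tau_edge e)%:R / (tau G)%:R)%R.

(* Densities are nonnegative, so the default 0 only matters when G has no
   edge. *)
Definition dep (G : multigraph) : rat :=
  \big[Num.max/0%R]_(e : edge G) density e.

(* A graph with a chosen edge and a labelling u, v of the ends of that edge. *)
Record bead := Bead {
  bead_graph :> multigraph;
  bead_edge : edge bead_graph;
  bead_u : vertex bead_graph;
  bead_v : vertex bead_graph;
  bead_edgeP : joins bead_edge bead_u bead_v
}.

Section Necklace.
Variables (n : nat) (B : 'I_n -> bead).

Let point : finType := {i : 'I_n & vertex (B i)}.

Definition upoint (i : 'I_n) : point := Tagged (fun i => vertex (B i)) (bead_u (B i)).
Definition vpoint (i : 'I_n) : point := Tagged (fun i => vertex (B i)) (bead_v (B i)).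

(* The end v of bead i is glued to the end u of bead i + 1 mod n. *)
Definition glue : rel point := fun x y =>
  [exists i : 'I_n, ((x == vpoint i) && (y == upoint (ordS i)))
                 || ((y == vpoint i) && (x == upoint (ordS i)))].

Lemma glue_sym : symmetric glue.
Proof. by move=> x y; apply: eq_existsb => i; rewrite orbC. Qed.

Lemma glued_sym : symmetric (connect glue).
Proof. exact: sym_connect_sym glue_sym. Qed.

Definition glued : equiv_rel point :=
  EquivRel (connect glue) (@connect0 _ glue) glued_sym (@connect_trans _ glue).

Definition necklace_quot : eqQuotType glued := {eq_quot glued}%qT.
Definition necklace_vertex : finType := quot_type necklace_quot.

Definition necklace_ends (f : {i : 'I_n & edge (B i)})
    : necklace_vertex * necklace_vertex :=
  let proj (x : vertex (B (tag f))) : necklace_vertex :=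
    \pi_necklace_quot%qT (Tagged (fun i => vertex (B i)) x) in
  (proj (ends (tagged f)).1, proj (ends (tagged f)).2).

Definition necklace : multigraph := Multigraph necklace_ends.

Definition key_edge (i : 'I_n) : edge necklace :=
  Tagged (fun i => edge (B i)) (bead_edge (B i)).

End Necklace.

Definition complete_bipartite (r s : nat) : multigraph :=
  @Multigraph ('I_r + 'I_s)%type ('I_r * 'I_s)%type
    (fun e => (inl e.1, inr e.2)).

Lemma joins_complete_bipartite r s (a : 'I_r) (b : 'I_s) :
  @joins (complete_bipartite r s) (a, b) (inl a) (inr b).
Proof. by rewrite /joins eqxx. Qed.

Definition bipartite_bead (r s : nat) (a : 'I_r) (b : 'I_s) : bead :=
  Bead (joins_complete_bipartite a b).

(* Main.v *)
(* The density of an edge [e = xy] is the effective resistance between [x] and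
   [y] when every edge is a unit resistor.  Counting the forests [F] with
   [e + F] a spanning tree by whether [z] is on the side of [x] gives a potential
   whose gradient is [tau G] times the unit current from [x] to [y].  Thomson's
   principle then bounds the density of an edge of a bead by its effective
   resistance [(r + s - 1) / (r s) = 1 / t] inside that bead alone, and
   [1 / t <= p / q].  The key edge [e_1] is a unit resistor in parallel with a
   series of resistors of total resistance [sum 1 / t_i = p / (q - p)], which
   gives [p / q]. *)
Require Import Defs.
From mathcomp Require Import all_boot all_order all_algebra.
From mathcomp Require Import ring lra zify.
Set Implicit Arguments.
Unset Strict Implicit.
Unset Printing Implicit Defensive.
Import Order.TTheory GRing.Theory Num.Theory.
Local Open Scope ring_scope.

(** * Spanning trees as minimal connected edge sets, and edge exchange *)

Section SpanningTrees.
Variable G : multigraph.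
Implicit Types (T F : {set edge G}) (e f g : edge G) (a b v x y : vertex G).

Local Notation conn T := (connect (adjacent T)).

Lemma joinsC e x y : joins e x y = joins e y x.
Proof. exact: orbC. Qed.

Lemma joins_ends e : joins e (ends e).1 (ends e).2.
Proof. by rewrite /joins -surjective_pairing eqxx. Qed.

Lemma joins_inj e x y a b :
  joins e x y -> joins e a b -> (x = a /\ y = b) \/ (x = b /\ y = a).
Proof.
by rewrite /joins => /orP[]/eqP-> /orP[]/eqP[-> ->]; auto.
Qed.

Lemma adjacent_sym T : symmetric (adjacent T).
Proof. by move=> x y; apply: eq_existsb => e; rewrite joinsC. Qed.

Lemma conn_sym T : connect_sym (adjacent T).
Proof. exact: sym_connect_sym (@adjacent_sym T). Qed.

Lemma adjacent_conn T f a b : f \in T -> joins f a b -> conn T a b.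
Proof.
by move=> fT fab; apply/connect1/existsP; exists f; rewrite fT.
Qed.

Lemma sub_conn T F : T \subset F -> subrel (conn T) (conn F).
Proof.
move=> sTF; apply: connect_sub => x y /existsP[e /andP[eT exy]].
exact: adjacent_conn (subsetP sTF _ eT) exy.
Qed.

Lemma connectedP T : reflect (forall x y, conn T x y) (connected T).
Proof. by apply: (iffP forallP) => H x; apply/forallP. Qed.

(** The vertices that [F] links to [a] or [b] form a set closed under adjacency in [f |: F], since
    [f] itself stays inside it. *)
Lemma connectedU1P F f a b : joins f a b ->
  reflect (forall v, conn F a v || conn F b v) (connected (f |: F)).
Proof.
move=> fab; have cfU := sub_conn (subsetUr [set f] F).
have cab : conn (f |: F) a b by apply: adjacent_conn fab; rewrite !inE eqxx.
apply: (iffP (connectedP _)) => [cF v|cF x y]; last first.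
  suff ca z : conn (f |: F) a z by apply: connect_trans (ca y); rewrite conn_sym.
  by case/orP: (cF z) => /cfU //; apply: connect_trans.
pose A := [pred z | conn F a z || conn F b z].
suff clA : closed (adjacent (f |: F)) A.
  by rewrite -[_ || _]/(v \in A) -(closed_connect clA (cF a v)) inE connect0.
move=> x y /existsP[g /andP[/setU1P[->|gF] gxy]].
  by case: (joins_inj gxy fab) => -[-> ->]; rewrite !inE !connect0 ?orbT.
have cxy := adjacent_conn gF gxy.
by rewrite !inE !(same_connect_r (@conn_sym F) cxy).
Qed.

Lemma connectedU1_conn F f a b :
  joins f a b -> connected (f |: F) -> conn F a b -> connected F.
Proof.
move=> fab /(connectedU1P _ fab) cU cab; have ca v : conn F a v.
  by case/orP: (cU v) => //; apply: connect_trans.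
by apply/connectedP => x y; apply: connect_trans (ca y); rewrite conn_sym.
Qed.

(** Take for [f] the closing edge of the cycle: the remaining edges form a path between its ends. *)
Lemma cycle_conn T : has_cycle T ->
  exists f a b, [/\ f \in T, joins f a b & conn (T :\ f) a b].
Proof.
case/existsP=> k /existsP[x /existsP[c]].
case/and3P=> /injectiveP injx /injectiveP injc.
move/forallP=> cyc; exists (c ord_max), (x ord_max), (x ord0).
have /andP[cT cj] := cyc ord_max.
have e0 : ordS (ord_max : 'I_k.+1) = ord0 by apply: val_inj; rewrite /= modnn.
rewrite e0 in cj; split=> //.
rewrite conn_sym.
suff H m : (m <= k)%N -> conn (T :\ c ord_max) (x ord0) (x (inord m)).
  by have := H k (leqnn k); congr connect; congr (x _);
    by apply: val_inj; rewrite /= inordK.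
elim: m => [|m IH] lemk.
  by rewrite (_ : inord 0 = ord0) ?connect0 //; apply: val_inj; rewrite /= inordK.
apply: connect_trans (IH (ltnW lemk)) _.
have /andP[cmT cmj] := cyc (inord m).
apply: (@adjacent_conn _ (c (inord m))).
  rewrite !inE cmT andbT; apply/eqP => /injc /(congr1 val) /=.
  by rewrite inordK ?ltnS ?(ltnW lemk) // => Em; rewrite Em ltnn in lemk.
move: cmj; congr joins; congr (x _); apply: val_inj => /=.
by rewrite !inordK ?modn_small // ltnS ltnW.
Qed.

(** A path from [a] to [b] avoiding [f], shortened so that its vertices are distinct, is closed up
    by [f]. *)
Lemma conn_cycle T f a b :
  f \in T -> joins f a b -> conn (T :\ f) a b -> has_cycle T.
Proof.
move=> fT fab /connectP[p' pP Eb]; rewrite {b}Eb in fab.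
case/shortenP: pP fab => p pP up _ fab {p'}.
have lt_p : (size p < #|vertex G|)%N.
  by rewrite -[(size p).+1]/(size (a :: p)) -(card_uniqP up) max_card.
pose x := [ffun i : 'I_(size p).+1 => nth a (a :: p) i].
(* The last index carries the closing edge [f]; the default of [odflt] is never reached, because
   consecutive path vertices are adjacent in [T :\ f]. *)
pose c := [ffun i : 'I_(size p).+1 => if (i < size p)%N then
  odflt f [pick g in T :\ f | joins g (x i) (x (ordS i))] else f].
have injx : injective x.
  move=> i j; rewrite !ffunE => /eqP.
  by rewrite nth_uniq ?ltn_ord // => /eqP/val_inj.
have cl (i : 'I_(size p).+1) : (i < size p)%N ->
    (c i \in T :\ f) && joins (c i) (x i) (x (ordS i)).
  move=> lti; rewrite [c i]ffunE lti; case: pickP => [g //|nog].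
  have /existsP[g gP] := pathP a pP i lti.
  by have := nog g; rewrite /= !ffunE /= modn_small // [X in X = _]gP.
have cm (i : 'I_(size p).+1) : (i < size p)%N = false ->
    [/\ val i = size p, c i = f & joins f (x i) (x (ordS i))].
  move=> gei; rewrite [c i]ffunE gei.
  have ei : val i = size p.
    by apply/eqP; rewrite eqn_leq -ltnS ltn_ord /= leqNgt gei.
  split=> //; rewrite joinsC !ffunE /= ei modnn /=.
  by move: fab; rewrite (last_nth a).
apply/existsP; exists (Ordinal lt_p); apply/existsP; exists x.
apply/existsP; exists c; apply/and3P; split.
- exact/injectiveP.
- apply/injectiveP => i j Ec.
  case lti: (i < size p)%N; case ltj: (j < size p)%N.
  + have /andP[_ ji] := cl i lti; have /andP[_ jj] := cl j ltj.
    rewrite Ec in ji; case: (joins_inj ji jj) => -[/injx // Ei /injx Ej].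
    (* An edge used twice in opposite directions would give [i = j + 1] and [j = i + 1]. *)
    move: (congr1 val Ei) (congr1 val Ej); rewrite /= !modn_small // => -> Ej'.
    by have : (j.+2 = j)%N by []; lia.
  + have /andP[] := cl i lti; rewrite Ec; have [_ -> _] := cm j ltj.
    by rewrite !inE eqxx.
  + have /andP[] := cl j ltj; rewrite -Ec; have [_ -> _] := cm i lti.
    by rewrite !inE eqxx.
  + by apply: val_inj; have [-> _ _] := cm i lti; have [-> _ _] := cm j ltj.
- apply/forallP => i; case lti: (i < size p)%N.
    by have /andP[/setD1P[_ ->] ->] := cl i lti.
  by have [_ -> ->] := cm i lti; rewrite fT.
Qed.

(** An edge lies on a cycle exactly when its ends stay linked without it, so for a connected set
    acyclicity amounts to minimality. *)
Lemma spanning_treeP T : reflect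
  (connected T /\ forall f, f \in T -> ~~ connected (T :\ f)) (spanning_tree T).
Proof.
apply: (iffP andP) => -[cT H]; split=> //.
  move=> f fT; apply: contra H => /connectedP/(_ (ends f).1 (ends f).2).
  exact: conn_cycle fT (joins_ends f).
apply/negP => /cycle_conn[f [a [b [fT fab cab]]]].
case/negP: (H f fT); apply: connectedU1_conn fab _ cab.
by rewrite setD1K.
Qed.

Lemma tau_gt0 : connected [set: edge G] -> (0 < tau G)%N.
Proof.
move=> cG; have [T minT _] := minset_exists cG.
apply/card_gt0P; exists T; rewrite inE; apply/spanning_treeP.
have [cT minT'] := minsetP minT; split=> // f fT; apply/negP => cTf.
have := minT' _ cTf (subD1set _ _) => E; move: fT.
by rewrite -E !inE eqxx.
Qed.

(** These are the spanning forests with two components, one containing each end of [e]. *)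
Definition near_tree e F := (e \notin F) && spanning_tree (e |: F).

Lemma near_treeP e F x y : joins e x y -> near_tree e F ->
  conn F x y = false /\ forall v, conn F y v = ~~ conn F x v.
Proof.
move=> exy /andP[eF /spanning_treeP[cF /(_ e)]].
rewrite setU11 setU1K // => /(_ isT) ncF.
have nxy : conn F x y = false.
  by apply: contraNF ncF; apply: connectedU1_conn exy cF.
split=> // v; have := elimT (connectedU1P _ exy) cF v.
case: (boolP (conn F x v)) => //= cxv _.
by rewrite -(same_connect_r (@conn_sym F) cxv) conn_sym.
Qed.

(** Minimality need only be tested at the edges of [F]: dropping [e] separates [x] from [y]. *)
Lemma near_treePf e F x y : joins e x y -> conn F x y = false ->
  (forall v, conn F x v || conn F y v) ->
  (forall g, g \in F -> ~~ connected (e |: F :\ g)) -> near_tree e F.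
Proof.
move=> exy nxy cU minF.
have eF : e \notin F by apply: contraFN nxy => eF; apply: adjacent_conn eF exy.
rewrite /near_tree eF; apply/spanning_treeP; split.
  exact/(connectedU1P _ exy).
move=> g /setU1P[->|gF].
  by rewrite setU1K //; apply: contraFN nxy => /connectedP->.
apply: contra (minF g gF); congr connected.
apply/setP => h; rewrite !inE; case: (h =P e) => //= ->.
by rewrite andbT; apply: contraNneq eF => ->.
Qed.

(** [F] splits the vertices into two sides, and any edge crossing between them can take the place of
    [e]. *)
Lemma near_tree_exchange e f F x y a b : joins e x y -> joins f a b ->
  near_tree e F -> conn F x a != conn F x b -> near_tree f F.
Proof.
wlog xa : a b / conn F x a.
  move=> W exy fab eF; have [xa|xa] := boolP (conn F x a).
    by move=> n; apply: (W a b) => //; rewrite xa.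
  case xb: (conn F x b) => // _.
  by apply: (W b a) => //; rewrite ?xb ?(negbTE xa) // joinsC.
rewrite xa => exy fab eF xb.
have {}xb : conn F x b = false by case: (conn F x b) xb.
have [nxy cE] := near_treeP exy eF.
have yb : conn F y b by rewrite cE xb.
have sx := same_connect (@conn_sym F) xa.
have sy := same_connect (@conn_sym F) yb.
apply: (near_treePf fab).
- by rewrite -sx xb.
- by move=> v; rewrite -sx -sy cE orbN.
move=> g gF; apply/negP => /(connectedU1P _ fab) cab.
case/andP: eF => eF /spanning_treeP[_ /(_ g)].
rewrite !inE gF orbT => /(_ isT)/negP[].
have -> : (e |: F) :\ g = e |: F :\ g.
  apply/setP => h; rewrite !inE; case: (h =P e) => //= ->.
  by rewrite andbT; apply: contraNneq eF => ->.
have up := sub_conn (subD1set F g).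
apply/(connectedU1P _ exy) => v.
(* If [f] reconnects [F :\ g], then [a] is still linked to [x] and [b] to [y], since links across
   the two sides are absent even in [F]. Hence [e] reconnects it too, against the minimality of
   [e |: F]. *)
have ax : conn (F :\ g) a x.
  case/orP: (cab x) => // /up; rewrite conn_sym xb //.
have by' : conn (F :\ g) b y.
  case/orP: (cab y) => // /up; rewrite -sx nxy //.
by rewrite -(same_connect (@conn_sym _) ax) -(same_connect (@conn_sym _) by').
Qed.

End SpanningTrees.

(** * Unit flows, forest potentials and Thomson's principle *)

Section Electrical.
Variable G : multigraph.
Implicit Types (T F : {set edge G}) (e f g : edge G) (x y z : vertex G).
Implicit Types (phi psi : vertex G -> rat) (theta : edge G -> rat).

Local Notation conn T := (connect (adjacent T)).

Definition grad phi e : rat := phi (ends e).1 - phi (ends e).2.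

(* Kirchhoff's node law, tested against an arbitrary potential. *)
Definition unit_flow x y theta :=
  forall phi, \sum_e theta e * grad phi e = phi x - phi y.

(* The summand is [grad phi f] with the sign with which the path of [T] from [x]
   to [y] traverses [f], and 0 if it avoids [f]. *)
Lemma tree_flow T x y phi : spanning_tree T ->
  \sum_(f in T) ((conn (T :\ f) (ends f).1 x)%:R
                 - (conn (T :\ f) (ends f).1 y)%:R) * grad phi f
  = phi x - phi y.
Proof.
move=> /spanning_treeP[cT minT].
(* [h - phi] is constant along each edge [g] of [T]: the ends of [g] remain linked in [T :\ f] for
   every other [f], so only the term of [g] changes. *)
pose h z := \sum_(f in T) (conn (T :\ f) (ends f).1 z)%:R * grad phi f.
have adjh z w : adjacent T z w -> h z - phi z = h w - phi w.
  case/existsP => g /andP[gT gzw].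
  suff E : h z - h w = phi z - phi w by move: E; lra.
  have nzw : conn (T :\ g) z w = false.
    by apply: contraNF (minT g gT);
      apply: connectedU1_conn gzw _; rewrite setD1K.
  rewrite /h -sumrB (bigD1 g) //= big1 ?addr0 => [|f /andP[fT fg]]; last first.
    have cf : conn (T :\ f) z w.
      by apply: adjacent_conn gzw; rewrite !inE eq_sym fg.
    by rewrite (same_connect_r (@conn_sym _ _) cf) subrr.
  rewrite /grad; case/orP: gzw => /eqP->; rewrite connect0 /= ?nzw.
    by rewrite mul0r mul1r subr0.
  by rewrite conn_sym nzw mul0r mul1r sub0r opprB.
suff hE z : h z - phi z = h y - phi y.
  have <- : h x - h y = phi x - phi y by move: (hE x); lra.
  by rewrite /h -sumrB; apply: eq_bigr => f _; rewrite mulrBl.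
pose A := [pred v | h v - phi v == h y - phi y].
suff clA : closed (adjacent T) A.
  apply/eqP; rewrite -[_ == _]/(z \in A).
  by rewrite (closed_connect clA (connectedP _ cT z y)) inE.
by move=> u v /adjh; rewrite !inE => ->.
Qed.

Definition forest_potential e x z : rat :=
  \sum_(F | near_tree e F) (conn F x z)%:R.

(** Deleting [f] is a bijection from the trees through [f] to the forests that [f] completes. *)
Lemma big_tree_near_tree f (h : {set edge G} -> rat) :
  \sum_(T | spanning_tree T && (f \in T)) h (T :\ f)
  = \sum_(F | near_tree f F) h F.
Proof.
rewrite (reindex_onto (fun F => f |: F) (fun T => T :\ f)) /=; last first.
  by move=> T /andP[_ /setD1K].
apply: eq_big => [F|F /andP[_ /eqP->]] //.
rewrite setU11 andbT /near_tree andbC; congr andb.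
have [fF|fF] := boolP (f \in F); last by rewrite setU1K ?eqxx.
by apply/eqP => E; move: fF; rewrite -E !inE eqxx.
Qed.

Lemma tau_edgeE e : (tau_edge e)%:R = \sum_(F | near_tree e F) 1 :> rat.
Proof.
rewrite -(big_tree_near_tree e (fun=> 1)) sumr_const /tau_edge.
by congr (_ *+ _); apply: eq_card => T; rewrite !inE.
Qed.

Lemma forest_potential_drop e x y : joins e x y ->
  forest_potential e x x - forest_potential e x y = (tau_edge e)%:R.
Proof.
move=> exy; rewrite -sumrB tau_edgeE; apply: eq_bigr => F eF.
by have [-> _] := near_treeP exy eF; rewrite connect0 subr0.
Qed.

(** Every spanning tree carries a unit flow from [x] to [y] along its path. Summing these over all
    trees and regrouping by the forest [T :\ f] gives the gradient of the forest potential. *)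
Lemma forest_potential_energy e x y phi : joins e x y ->
  \sum_f grad (forest_potential e x) f * grad phi f
  = (tau G)%:R * (phi x - phi y).
Proof.
move=> exy.
transitivity (\sum_(T : {set edge G} | spanning_tree T) (phi x - phi y));
  last first.
  rewrite sumr_const mulr_natl; congr (_ *+ _).
  by apply: eq_card => T; rewrite !inE.
under [RHS]eq_bigr => T sT do rewrite -(tree_flow x y phi sT).
rewrite (exchange_big_dep predT) //=; apply: eq_bigr => f _.
rewrite (big_tree_near_tree f (fun F => ((conn F (ends f).1 x)%:R
  - (conn F (ends f).1 y)%:R) * grad phi f)) -mulr_suml; congr (_ * _).
rewrite /grad -sumrB [LHS]big_mkcond [RHS]big_mkcond /=; apply: eq_bigr => F _.
have fj := joins_ends f; set a := (ends f).1 in fj *.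
set b := (ends f).2 in fj *.
have symF := @conn_sym _ F.
(* If both [e] and [f] complete [F], they cross the same cut and the two differences agree. If only
   one of them does, exchange shows that the other does not cross, so the difference is 0. *)
case: ifPn => eF; case: ifPn => fF //.
- have [nxy yE] := near_treeP exy eF; have [nab bE] := near_treeP fj fF.
  rewrite ![conn F a _]symF yE; have [xa|xa] := boolP (conn F x a).
    by rewrite -(same_connect symF xa) in nab; rewrite nab.
  by rewrite symF bE symF xa.
- case: (boolP (conn F x a == conn F x b)) => [/eqP->|n].
    by rewrite subrr.
  by rewrite (near_tree_exchange exy fj eF n) in fF.
case: (boolP (conn F a x == conn F a y)) => [/eqP->|n]; first by rewrite subrr.
by rewrite (near_tree_exchange fj exy fF n) in eF.
Qed.

Lemma forest_potential_norm e x y : joins e x y ->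
  \sum_f grad (forest_potential e x) f ^+ 2 = (tau G)%:R * (tau_edge e)%:R.
Proof.
move=> exy; rewrite -(forest_potential_drop exy).
by rewrite -(forest_potential_energy _ exy).
Qed.

(* Thomson's principle: the current minimises the energy among unit flows. *)
Lemma density_le_energy e x y theta : connected [set: edge G] ->
  joins e x y -> unit_flow x y theta -> density e <= \sum_f theta f ^+ 2.
Proof.
move=> cG exy flow; set psi := forest_potential e x.
have tau0 : 0 < (tau G)%:R :> rat by rewrite ltr0n tau_gt0.
set m : rat := (tau_edge e)%:R; set N : rat := (tau G)%:R in tau0 *.
(* Squared distance from [theta] to the unit current [grad psi / N]. The cross term pairs the flow
   with [psi] and equals [m]; the square of [grad psi] sums to [N * m]. *)
have le0 : 0 <= \sum_f (theta f - grad psi f / N) ^+ 2.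
  by apply: sumr_ge0 => f _; apply: sqr_ge0.
have E : \sum_f (theta f - grad psi f / N) ^+ 2
    = \sum_f theta f ^+ 2 - m / N.
  have -> : \sum_f (theta f - grad psi f / N) ^+ 2 = \sum_f theta f ^+ 2
      - 2 / N * (\sum_f theta f * grad psi f)
      + N ^- 2 * (\sum_f grad psi f ^+ 2).
    rewrite !mulr_sumr -sumrB -big_split; apply: eq_bigr => f _ /=.
    by field; rewrite gt_eqF.
  rewrite flow forest_potential_drop // (forest_potential_norm exy) -/m -/N.
  by field; rewrite gt_eqF.
by rewrite /density -subr_ge0 -E.
Qed.

(** Reciprocity: pair [grad phi] with the gradient of the forest potential, and evaluate by the flow
    property of either one. *)
Lemma density_potential e x y phi : connected [set: edge G] ->
  joins e x y -> unit_flow x y (grad phi) -> density e = phi x - phi y.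
Proof.
move=> cG exy flow.
have tau0 : (tau G)%:R != 0 :> rat by rewrite pnatr_eq0 -lt0n tau_gt0.
rewrite /density -(forest_potential_drop exy) -flow.
under eq_bigr => f _ do rewrite mulrC.
by rewrite (forest_potential_energy _ exy) mulrC mulKf.
Qed.

End Electrical.

(** * The unit current between adjacent vertices of a complete bipartite graph *)

Section CompleteBipartite.
Variables r s : nat.
Hypotheses (r_gt0 : (0 < r)%N) (s_gt0 : (0 < s)%N).
Implicit Types (a : 'I_r) (b : 'I_s).

(* The grounding constant is chosen to make [bipartite_flow] simple; the drop
   from [inl a] to [inr b] is [(r + s - 1) / (r s)]. *)
Definition bipartite_potential a b
    (z : vertex (complete_bipartite r s)) : rat :=
  match z with
  | inl x => (x == a)%:R / s%:R
  | inr y => (r%:R * s%:R)^-1 - (y == b)%:R / r%:R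
  end.

(** The current from [x] to [y] is [[x = a] / s + [y = b] / r - 1 / (r s)]; it sums to [[x = a]]
    over [y] and to [[y = b]] over [x]. *)
Lemma bipartite_unit_flow a b :
  @unit_flow (complete_bipartite r s) (inl a) (inr b)
    (grad (bipartite_potential a b)).
Proof.
move=> phi; have r0 : r%:R != 0 :> rat by rewrite pnatr_eq0 -lt0n.
have s0 : s%:R != 0 :> rat by rewrite pnatr_eq0 -lt0n.
transitivity (\sum_(x < r) \sum_(y < s)
   ((x == a)%:R / s%:R - ((r%:R * s%:R)^-1 - (y == b)%:R / r%:R))
   * (phi (inl x) - phi (inr y))).
  by rewrite pair_bigA; apply: eq_bigr => -[x y] _.
set Y := \sum_(y < s) phi (inr y).
have inner x : \sum_(y < s)
   ((x == a)%:R / s%:R - ((r%:R * s%:R)^-1 - (y == b)%:R / r%:R))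
   * (phi (inl x) - phi (inr y))
  = (x == a)%:R * (phi (inl x) - Y / s%:R)
    + (Y / s%:R - phi (inr b)) / r%:R.
  pose c : rat := (x == a)%:R / s%:R - (r%:R * s%:R)^-1.
  transitivity (\sum_(y < s) (c * phi (inl x) - c * phi (inr y)
      + (y == b)%:R * ((phi (inl x) - phi (inr y)) / r%:R))).
    by apply: eq_bigr => y _; rewrite /c; ring.
  rewrite big_split sumrB /= sumr_const card_ord -mulr_natl -mulr_sumr -/Y.
  rewrite [X in _ + X](bigD1 b) //= big1 ?addr0 => [|y /negbTE->];
    last by rewrite mul0r.
  by rewrite eqxx mul1r /c; field; rewrite r0.
under eq_bigr => x _ do rewrite inner.
rewrite big_split /= sumr_const card_ord (bigD1 a) //=.
rewrite big1 ?addr0 => [|x /negbTE->]; last by rewrite mul0r.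
by rewrite eqxx mul1r -mulr_natl; field; rewrite r0.
Qed.

Lemma bipartite_potential_drop a b :
  bipartite_potential a b (inl a) - bipartite_potential a b (inr b)
  = (r%:R + s%:R - 1) / (r%:R * s%:R).
Proof.
have r0 : r%:R != 0 :> rat by rewrite pnatr_eq0 -lt0n.
have s0 : s%:R != 0 :> rat by rewrite pnatr_eq0 -lt0n.
by rewrite /= !eqxx /=; field; rewrite r0 s0.
Qed.

Lemma complete_bipartite_connected a b :
  connected [set: edge (complete_bipartite r s)].
Proof.
pose K := complete_bipartite r s.
have adj (x : 'I_r) (y : 'I_s) :
    connect (adjacent [set: edge K]) (inl x) (inr y).
  by apply: (@adjacent_conn K _ (x, y)); rewrite ?inE ?joins_complete_bipartite.
apply/connectedP.
suff ca v : connect (adjacent [set: edge K]) (inl a) v.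
  by move=> u v; apply: connect_trans (ca v); rewrite conn_sym.
case: v => [x|y] //; apply: connect_trans (adj a b) _.
by rewrite conn_sym.
Qed.

End CompleteBipartite.

(** * Flows and potentials on a necklace *)

Section Necklace.
Variables (n : nat) (B : 'I_n -> bead).
Let N := necklace B.

Local Notation point := {i : 'I_n & vertex (B i)}.

Definition bead_vertex (i : 'I_n) (x : vertex (B i)) : vertex N :=
  \pi_(necklace_quot B)%qT (Tagged (fun i => vertex (B i)) x).

Lemma bead_vertex_glue i :
  bead_vertex (bead_v (B i)) = bead_vertex (bead_u (B (ordS i))).
Proof.
apply/(eqquotP (necklace_quot B)); apply: connect1; apply/existsP; exists i.
by rewrite !eqxx.
Qed.

Lemma ends_bead_edge (i : 'I_n) (f : edge (B i)) :
  ends (Tagged (fun i => edge (B i)) f : edge N) =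
  (bead_vertex (ends f).1, bead_vertex (ends f).2).
Proof. by []. Qed.

Lemma joins_bead_edge (i : 'I_n) (f : edge (B i)) x y : joins f x y ->
  joins (Tagged (fun i => edge (B i)) f : edge N)
    (bead_vertex x) (bead_vertex y).
Proof.
by rewrite /joins ends_bead_edge => /orP[]/eqP->; rewrite eqxx ?orbT.
Qed.

Lemma bead_vertex_surj (z : vertex N) : exists i x, z = bead_vertex (i := i) x.
Proof.
case E : (repr z) => [i x]; exists i, x; rewrite -[z]reprK E //.
Qed.

(** Agreement at glued points makes the potentials constant on gluing classes, so evaluation at a
    representative is well defined. *)
Lemma necklace_potential (phi : forall i, vertex (B i) -> rat) :
  (forall i, phi i (bead_v (B i)) = phi (ordS i) (bead_u (B (ordS i)))) ->
  exists Phi : vertex N -> rat,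
    forall i (x : vertex (B i)), Phi (bead_vertex x) = phi i x.
Proof.
move=> glueP; pose phi' (p : point) := phi (tag p) (tagged p).
exists (fun z => phi' (repr (z : necklace_quot B))) => i x.
pose p : point := Tagged (fun i => vertex (B i)) x; rewrite -[RHS]/(phi' p).
have /(eqquotP (necklace_quot B)) : repr (\pi_(necklace_quot B)%qT p)
   = p %[mod necklace_quot B]%qT by rewrite reprK.
pose A c := [pred q : point | phi' q == c].
have clA c : closed (glue (B:=B)) (A c).
  move=> u v /existsP[j /orP[]/andP[/eqP-> /eqP->]]; rewrite !inE /phi' /=;
  by rewrite glueP.
by move/(closed_connect (clA (phi' p))); rewrite !inE eqxx => /eqP.
Qed.

Lemma sum_bead_edges (h : edge N -> rat) :
  \sum_f h f = \sum_i \sum_(f : edge (B i)) h (Tagged (fun i => edge (B i)) f).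
Proof.
rewrite (sig_big_dep _ (fun _ _ => true)
  (fun i (f : edge (B i)) => h (Tagged (fun i => edge (B i)) f))) /=.
by apply: eq_bigr => -[].
Qed.

Lemma grad_bead_edge (phi : vertex N -> rat) i (f : edge (B i)) :
  grad phi (Tagged (fun i => edge (B i)) f : edge N) =
  grad (fun x => phi (bead_vertex x)) f.
Proof. by []. Qed.

(** [untag 0 theta] extends [theta] by 0 to the other beads. *)
Lemma sum_untag k (theta : edge (B k) -> rat) (h : rat -> edge N -> rat) :
  (forall f, h 0 f = 0) ->
  \sum_f h (untag 0 theta f) f
  = \sum_f h (theta f) (Tagged (fun i => edge (B i)) f).
Proof.
move=> h0; rewrite sum_bead_edges (bigD1 k) //= [X in _ + X]big1 ?addr0.
  by apply: eq_bigr => f _;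
    rewrite (untagE 0 theta (u := Tagged (fun i => edge (B i)) f) erefl).
by move=> i ik; apply: big1 => f _; rewrite untag_dflt ?h0.
Qed.

Lemma bead_unit_flow k (theta : edge (B k) -> rat) x y :
  unit_flow x y theta ->
  unit_flow (bead_vertex x) (bead_vertex y) (untag 0 theta : edge N -> rat).
Proof.
move=> flow phi; rewrite (sum_untag _ (h := fun c f => c * grad phi f)).
  exact: (flow (fun x => phi (bead_vertex x))).
by move=> f; rewrite mul0r.
Qed.

(** A flow confined to one bead is a competitor in Thomson's principle for the whole necklace. *)
Lemma bead_density_le k (e : edge (B k)) x y (theta : edge (B k) -> rat) :
  connected [set: edge N] -> joins e x y -> unit_flow x y theta ->
  density (Tagged (fun i => edge (B i)) e : edge N) <= \sum_f theta f ^+ 2.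
Proof.
move=> cN exy flow.
have := density_le_energy cN (joins_bead_edge exy) (bead_unit_flow flow).
by rewrite (sum_untag _ (h := fun c _ => c ^+ 2)) // => f; rewrite expr0n.
Qed.

Lemma necklace_connected :
  (forall i, connected [set: edge (B i)]) -> connected [set: edge N].
Proof.
move=> cB; pose c := connect (adjacent [set: edge N]).
have inb i (x y : vertex (B i)) : c (bead_vertex x) (bead_vertex y).
  have /connectP[p pP ->] := connectedP _ (cB i) x y.
  elim: p x pP => [|z p IH] x /= ; first by rewrite /c connect0.
  case/andP=> /existsP[e /andP[_ /joins_bead_edge ej]] /IH.
  by apply: connect_trans; apply: adjacent_conn ej; rewrite inE.
(* Walks forward from bead [i] to bead [j] without wrapping around; symmetry covers the other
   order. *)
have uu m (i j : 'I_n) : (i + m)%N = j ->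
    c (bead_vertex (bead_u (B i))) (bead_vertex (bead_u (B j))).
  elim: m j => [|m IH] j ij.
    by rewrite addn0 in ij; rewrite (val_inj ij) /c connect0.
  have lt : (i + m < n)%N by rewrite addnS in ij; rewrite ltnW // ij ltn_ord.
  apply: connect_trans (IH (Ordinal lt) erefl) _.
  have -> : j = ordS (Ordinal lt).
    by apply: val_inj; rewrite /= -addnS modn_small ij ?ltn_ord.
  by rewrite -bead_vertex_glue; apply: inb.
apply/connectedP => z w.
have [i [x ->]] := bead_vertex_surj z; have [j [y ->]] := bead_vertex_surj w.
apply: connect_trans (inb i x (bead_u (B i))) _.
apply: connect_trans (inb j (bead_u (B j)) y).
by case/orP: (leq_total i j) => /subnKC/uu //; rewrite /c conn_sym.
Qed.

(* The key edge [k] is in parallel with the series of all other beads. *)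
Lemma key_edge_density k (phi : forall i, vertex (B i) -> rat)
    (R : 'I_n -> rat) :
  connected [set: edge N] ->
  (forall i, unit_flow (bead_u (B i)) (bead_v (B i)) (grad (phi i))) ->
  (forall i, phi i (bead_u (B i)) - phi i (bead_v (B i)) = R i) ->
  \sum_i R i != 0 ->
  density (key_edge B k) = R k * (\sum_i R i - R k) / \sum_i R i.
Proof.
move=> cN flow drop S0; set S := \sum_i R i in S0 *.
(* [I i] is the current through bead [i] from [v] to [u]. *)
pose I (i : 'I_n) : rat := R k / S - (i == k)%:R.
(* [A j] is the potential at the end [u] of bead [j]. The constant [R k / S] in [I] is what makes
   the drops cancel around the loop, that is [A n = 0]. *)
pose A j : rat := \sum_(i < n | (i < j)%N) I i * R i.
have A0 : A 0%N = 0 by rewrite /A big1.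
have An : A n = 0.
  rewrite /A (eq_bigl predT) => [|i]; last by rewrite ltn_ord.
  under eq_bigr => i _ do rewrite mulrBl.
  rewrite sumrB -mulr_sumr -/S divfK // (bigD1 k) //= big1 ?addr0.
    by rewrite eqxx mul1r subrr.
  by move=> i /negbTE->; rewrite mul0r.
have AS (i : 'I_n) : A i.+1 = A i + I i * R i.
  rewrite /A (bigD1 i) //= addrC; congr (_ + _); apply: eq_bigl => j.
  by rewrite ltnS [RHS]ltn_neqAle andbC.
have AoS (i : 'I_n) : A (ordS i) = A i.+1.
  rewrite /=; have [lt|] := ltnP i.+1 n; first by rewrite modn_small.
  have := ltn_ord i; rewrite leq_eqVlt ltnNge => /orP[/eqP-> _|/negP//].
  by rewrite modnn A0 An.
(* Scaled and shifted to take the values [A i] at [u] and [A i.+1] at [v], so that neighbouring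
   beads agree. *)
pose psi (i : 'I_n) (x : vertex (B i)) :=
  A i.+1 - I i * (phi i x - phi i (bead_v (B i))).
have [|Psi PsiE] := @necklace_potential psi.
  by move=> i; rewrite /psi subrr mulr0 subr0 drop (AS (ordS i)) addrK AoS.
have ej := joins_bead_edge (bead_edgeP (B k)).
rewrite (density_potential (phi := Psi) cN ej).
  rewrite !PsiE /psi subrr mulr0 drop /I eqxx /=.
  by field.
move=> chi; rewrite sum_bead_edges.
transitivity (\sum_i - I i *
   (chi (bead_vertex (bead_u (B i))) - chi (bead_vertex (bead_v (B i))))).
  apply: eq_bigr => i _.
  rewrite -(flow i (fun x => chi (bead_vertex x))) mulr_sumr.
  apply: eq_bigr => f _; rewrite !grad_bead_edge mulrA; congr (_ * _).
  rewrite /grad !PsiE /psi; ring.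
(* The uniform current [R k / S] telescopes around the loop, leaving only the unit current through
   bead [k]. *)
under eq_bigr => i _ do rewrite opprB mulrBl.
rewrite sumrB (bigD1 k) //= eqxx mul1r [X in _ + X - _]big1 ?addr0; last first.
  by move=> i /negbTE->; rewrite mul0r.
rewrite -mulr_sumr sumrB.
under [X in _ * (_ - X)]eq_bigr => i _ do rewrite bead_vertex_glue.
rewrite -(reindex (@ordS n) (P := predT)
   (F := fun i => chi (bead_vertex (bead_u (B i))))) ?subrr ?mulr0 ?subr0 //.
exact/onW_bij/ordS_bij.
Qed.

End Necklace.

(** * Densities in necklaces of complete bipartite graphs *)

Lemma bipartite_bead_density_le n (r s : 'I_n -> nat)
    (a : forall i, 'I_(r i)) (b : forall i, 'I_(s i)) i
    (e : edge (complete_bipartite (r i) (s i))) :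
  let B := fun i => bipartite_bead (a i) (b i) in
  connected [set: edge (necklace B)] ->
  density (Tagged (fun i => edge (B i)) e : edge (necklace B))
    <= ((r i)%:R + (s i)%:R - 1) / ((r i)%:R * (s i)%:R).
Proof.
move=> B cN; case: e => x y.
have r_gt0 : (0 < r i)%N := leq_ltn_trans (leq0n _) (ltn_ord (a i)).
have s_gt0 : (0 < s i)%N := leq_ltn_trans (leq0n _) (ltn_ord (b i)).
have flow := bipartite_unit_flow r_gt0 s_gt0 x y.
have exy := joins_complete_bipartite x y.
have := bead_density_le (B := B) (k := i) cN exy flow.
(* Testing the current against its own potential turns its energy into the potential drop. *)
by rewrite -(bipartite_potential_drop r_gt0 s_gt0 x y)
  -(flow (bipartite_potential x y)).
Qed.

Theorem theorem2p8 (p q n : nat) (t r s : nat -> nat)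
    (p_gt0 : (0 < p)%N) (p_lt_q : (p < q)%N) (n_ge2 : (1 < n)%N)
    (t_gt0 : forall i : nat, (2 <= i <= n)%N -> (0 < t i)%N)
    (t_sum : \sum_(2 <= i < n.+1) ((t i)%:R)^-1 = p%:R / (q%:R - p%:R) :> rat)
    (t_ge : forall i : nat, (2 <= i <= n)%N -> q%:R / p%:R <= (t i)%:R :> rat)
    (r1 : r 1%N = 1%N) (s1 : s 1%N = 1%N)
    (r_def : forall i : nat, (2 <= i <= n)%N -> r i = (2 * t i)%N)
    (s_def : forall i : nat, (2 <= i <= n)%N -> s i = (2 * t i - 1)%N)
    (a : forall i : 'I_n, 'I_(r i.+1)) (b : forall i : 'I_n, 'I_(s i.+1)) :
  let G := necklace (fun i : 'I_n => bipartite_bead (a i) (b i)) in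
  let e1 : edge G :=
    key_edge (fun i : 'I_n => bipartite_bead (a i) (b i))
             (Ordinal (ltnW n_ge2)) in
  dep G = density e1 /\ density e1 = p%:R / q%:R.
Proof.
move=> G e1; pose B (i : 'I_n) := bipartite_bead (a i) (b i).
have r_gt0 (i : 'I_n) : (0 < r i.+1)%N :=
  leq_ltn_trans (leq0n _) (ltn_ord (a i)).
have s_gt0 (i : 'I_n) : (0 < s i.+1)%N :=
  leq_ltn_trans (leq0n _) (ltn_ord (b i)).
have cG : connected [set: edge G].
  by apply: necklace_connected => i; apply: complete_bipartite_connected.
have p0 : 0 < p%:R :> rat by rewrite ltr0n.
have pq : p%:R < q%:R :> rat by rewrite ltr_nat.
(* Resistance of bead [m], counted from 1 while the ordinals start at 0. For [m >= 2] it is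
   [(4 t - 2) / (2 t (2 t - 1)) = 1 / t]. *)
pose R (m : nat) : rat := ((r m)%:R + (s m)%:R - 1) / ((r m)%:R * (s m)%:R).
have R1 : R 1%N = 1 by rewrite /R r1 s1.
have Rt m : (2 <= m <= n)%N -> R m = (t m)%:R^-1.
  move=> m2; rewrite /R r_def // s_def //; have t0 := t_gt0 m m2.
  rewrite natrB ?muln_gt0 // natrM.
  have t1 : 1 <= (t m)%:R :> rat by rewrite ler1n.
  by field; rewrite !gt_eqF //; lra.
(* This is [1 + p / (q - p)], the 1 coming from the first bead. *)
have S_E : \sum_(i < n) R i.+1 = q%:R / (q%:R - p%:R).
  rewrite -(big_mkord predT (fun i => R i.+1)) -(big_add1 _ _ 0 n.+1 predT).
  rewrite big_ltn ?ltnS 1?ltnW //.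
  under eq_big_nat => m m2 do rewrite Rt //.
  rewrite R1 t_sum.
  by field; rewrite gt_eqF //; lra.
have d1 : density e1 = p%:R / q%:R.
  rewrite (@key_edge_density _ B _ (fun i => bipartite_potential (a i) (b i))
    (fun i => R i.+1)) //.
  - rewrite S_E R1; field; rewrite !gt_eqF //; lra.
  - by move=> i; apply: bipartite_unit_flow.
  - by move=> i; apply: bipartite_potential_drop.
  by rewrite S_E mulf_neq0 ?invr_eq0 ?gt_eqF //; lra.
split=> //; apply/le_anti/andP; split; last exact: le_bigmax.
apply: bigmax_le => [|e _]; first by rewrite d1 divr_ge0 ?ler0n.
(* The bead of index 0 is [K_{1,1}], with [e1] as its only edge; in the others the bound
   [1 / t <= p / q] applies. *)
case: e => i e; have [i0|i_gt0] := posnP i.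
  suff <- : Tagged (fun i => edge (B i)) e = e1 by [].
  have one m (u v : 'I_m) : m = 1%N -> u = v.
    by move=> m1; move: u v; rewrite m1 => u v; rewrite !ord1.
  have Ei : i = Ordinal (ltnW n_ge2) by apply: val_inj.
  rewrite /e1 /key_edge -Ei; congr (Tagged _ _); case: e => x y; congr (_, _).
    by apply: one; rewrite i0 r1.
  by apply: one; rewrite i0 s1.
apply: le_trans (bipartite_bead_density_le e cG) _.
have i2 : (2 <= i.+1 <= n)%N by rewrite ltnS i_gt0 ltn_ord.
rewrite -/(R i.+1) Rt // d1 -[_ / _]invf_div lef_pV2 ?t_ge // posrE.
  by rewrite ltr0n t_gt0.
by rewrite divr_gt0 // (lt_trans p0).
Qed.
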